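(* Let $\mathcal{D}$ be the set of smooth maps $f:]0,1[\to]0,1[$ with $\lim_{x\to0}f(x)=0$, $\lim_{x\to1}f(x)=1$ and $\inf_{x\in]0,1[}f'(x)>0$, equipped with the functional diffeology. There exists a smooth path $v:[0,1]\to T_{\mathrm{Id}_{]0,1[}}\mathcal{D}$ such that no smooth path $g:[0,1]\to\mathcal{D}$ satisfies the equation $$\partial_tg\circ g^{-1}=v .$$
   Context: A path $t\mapsto g_t$ in $\mathcal{D}$ is smooth (for the functional diffeology) if and only if $(t,x)\mapsto g_t(x)$ is smooth. $T_{\mathrm{Id}_{]0,1[}}\mathcal{D}$ is the internal tangent cone at the identity: the set of derivatives at $t=0$ of smooth paths $t\mapsto c_t$ in $\mathcal{D}$ with $c_0=\mathrm{Id}_{]0,1[}$, each of which is viewed as the smooth function $x\mapsto\partial_tc_t(x)|_{t=0}$ in $C^\infty(]0,1[,\mathbb{R})$. A path $t\mapsto v_t$ in it is smooth if $(t,x)\mapsto v_t(x)$ is smooth. Each $g\in\mathcal{D}$ is a diffeomorphism of $]0,1[$, with inverse map $g^{-1}$. The equation means $(\partial_tg_t)(g_t^{-1}(x))=v_t(x)$ for all $t\in[0,1]$ and $x\in]0,1[$. *)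

(* Defs.v *)
From HB Require Import structures.
From mathcomp Require Import all_boot all_order all_algebra.
From mathcomp Require Import all_classical all_reals all_analysis.

Set Implicit Arguments.
Unset Strict Implicit.
Unset Printing Implicit Defensive.

Import Order.TTheory GRing.Theory Num.Theory.
Import numFieldNormedType.Exports.

Local Open Scope ring_scope.
Local Open Scope classical_set_scope.

(* f is of class C^n on the open set U, for a finite-dimensional V (below,
   V = R or V = R * R): a C^n condition on every directional derivative 'D_w f
   is then the same as a C^n condition on the differential. *)
Fixpoint isC (R : realType) (V : normedModType R) (n : nat) (U : set V)
    (f : V -> R) : Prop :=
  if n is n'.+1 then
    (forall p, U p -> differentiable f p) /\ (forall w, isC n' U ('D_w f))
  else forall p, U p -> {for p, continuous f}.

Definition smooth_open (R : realType) (V : normedModType R) (U : set V)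
    (f : V -> R) : Prop := forall n, isC n U f.

(* Smoothness on a set S that need not be open: local existence of smooth
   extensions. For open S it amounts to smooth_open S. *)
Definition smooth_on (R : realType) (V : normedModType R) (S : set V)
    (f : V -> R) : Prop :=
  forall p, S p -> exists U : set V, exists h : V -> R,
    [/\ open U, U p, smooth_open U h & forall q, U q -> S q -> h q = f q].

Section IntervalDiffeomorphisms.
Variable R : realType.
Implicit Types (f u : R -> R) (g c v : R -> R -> R) (J : set R).

(* Maps defined on ]0,1[ are encoded as total functions whose values outside
   ]0,1[ are irrelevant. *)
Definition I01 : set R := `]0, 1[.

Definition D f : Prop :=
  [/\ smooth_open I01 f,
      (forall x, I01 x -> I01 (f x)),
      f x @[x --> 0^'+] --> (0 : R),
      f x @[x --> 1^'-] --> (1 : R) &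
      (0 < ereal_inf [set (derive1 f x)%:E | x in I01])%E].

(* A path is smooth for the functional diffeology if and only if it is jointly
   smooth in (t, x). *)
Definition jointly_smooth J g : Prop :=
  smooth_on (J `*` I01) (fun p : R * R => g p.1 p.2).

Definition smooth_path J g : Prop :=
  (forall t, J t -> D (g t)) /\ jointly_smooth J g.

Definition tangent_cone_id u : Prop :=
  exists c : R -> R -> R,
    [/\ smooth_path [set: R] c,
        (forall x, I01 x -> c 0 x = x) &
        (forall x, I01 x -> u x = derive1 (fun t => c t x) 0)].

Definition smooth_tangent_path J v : Prop :=
  (forall t, J t -> tangent_cone_id (v t)) /\ jointly_smooth J v.

(* Increments are taken inside J only, so the derivative is one-sided at the
   endpoints of an interval J. *)
Definition derive_in J f (t : R) : R :=
  lim ((s - t)^-1 * (f s - f t) @[s --> within J t^']).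

Definition inv01 f : R -> R := 'pinv_(fun=> 0) I01 f.

End IntervalDiffeomorphisms.

(* Main.v *)
Require Import Defs.
From HB Require Import structures.
From mathcomp Require Import all_boot all_order all_algebra.
From mathcomp Require Import all_classical all_reals all_analysis.
From mathcomp Require Import ring lra.

Set Implicit Arguments.
Unset Strict Implicit.
Unset Printing Implicit Defensive.

Import Order.TTheory GRing.Theory Num.Theory.
Import numFieldNormedType.Exports.

Local Open Scope ring_scope.
Local Open Scope classical_set_scope.

(* The tangent cone at the identity contains the constant function 1, whose
   flow x + t leaves ]0, 1[ by time 1. Indeed c_t(x) = x + t q^2 / (q^2 + 4 t^2)
   with q = x (1 - x) is smooth on R x ]0, 1[, has time derivative 1 at t = 0,
   and stays within q / 4 of the identity with x-derivative at least 1/2, so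
   that each c_t lies in D. A smooth path g with velocity 1 would satisfy
   g_1(y) - g_0(y) = 1, which is impossible in ]0, 1[. *)

(** * Closure properties of C^n functions on an open set *)

Lemma near_eq_differentiable (R : realType) (V W : normedModType R)
    (f g : V -> W) (p : V) :
  {near p, f =1 g} -> differentiable f p -> differentiable g p.
Proof.
move=> fg df; have fgp : f p = g p := nbhs_singleton fg.
(* The first-order expansion of [f] at [p] serves for [g] too; uniqueness of the differential then
   gives ['d g p = 'd f p]. *)
have dg : g \o shift p = cst (g p) + 'd f p +o_ 0 id.
  have /eqaddoP dfo := diff_locally df.
  apply/eqaddoP => e e0; near=> h.
  have gfh : g (h + p) = f (h + p).
    apply/esym; near: h; move: fg; rewrite [X in X -> _](near_shift 0).
    by apply: filterS => h /=; rewrite subr0.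
  rewrite !fctE/= gfh -fgp; near: h; exact: dfo.
have dfc : continuous ('d f p) by exact: diff_continuous.
by apply/diff_locallyP; rewrite (diff_unique dfc dg).
Unshelve. all: by end_near. Qed.

Section FiniteOrderSmoothness.
Variables (R : realType) (V : normedModType R) (U : set V).
Hypothesis oU : open U.
Implicit Types (f g : V -> R) (n : nat).

(** As [U] is open, agreement on [U] is agreement near each of its points, which preserves
    directional derivatives. Derivatives can thus be replaced by formulas valid on [U] only. *)
Lemma isC_ext n f g : (forall p, U p -> f p = g p) -> isC n U f -> isC n U g.
Proof.
have nearU f1 g1 p : (forall p, U p -> f1 p = g1 p) -> U p ->
    \forall q \near p, f1 q = g1 q.
  by move=> fg Up; near=> q; apply: fg; near: q; exact: open_nbhs_nbhs.
elim: n f g => [|n IH] f g fg /=.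
  move=> cf p Up; rewrite /prop_for /continuous_at -fg//.
  by apply: cvg_trans (cf p Up); apply: near_eq_cvg; exact: nearU.
move=> [df Df]; split=> [p Up|w].
  by apply: near_eq_differentiable (df p Up); exact: nearU.
apply: IH (Df w) => p Up.
by apply: near_eq_derive; exact: nearU.
Unshelve. all: by end_near. Qed.

Lemma isC_pred n f : isC n.+1 U f -> isC n U f.
Proof.
elim: n f => [|n IH] f [df Df].
  by move=> p Up; apply: differentiable_continuous; exact: df.
by split=> // w; exact: IH.
Qed.

Lemma isC_cst n (a : R) : isC n U (fun=> a).
Proof.
elim: n a => [|n IH] a /=; first by move=> p _; exact: cst_continuous.
split=> [p _|w]; first exact: differentiable_cst.
by apply: (@isC_ext n (fun=> 0)) => // p _; rewrite derive_cst.
Qed.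

Lemma isCD n f g : isC n U f -> isC n U g -> isC n U (fun p => f p + g p).
Proof.
elim: n f g => [|n IH] f g /=.
  by move=> cf cg p Up; apply: continuousD; [exact: cf|exact: cg].
move=> [df Df] [dg Dg]; split=> [p Up|w].
  by apply: differentiableD; [exact: df|exact: dg].
apply: isC_ext (IH _ _ (Df w) (Dg w)) => p Up.
by rewrite -deriveD//; apply: diff_derivable; [exact: df|exact: dg].
Qed.

Lemma isCM n f g : isC n U f -> isC n U g -> isC n U (fun p => f p * g p).
Proof.
elim: n f g => [|n IH] f g.
  by move=> cf cg p Up; apply: continuousM; [exact: cf|exact: cg].
move=> Cf Cg; have [df Df] := Cf; have [dg Dg] := Cg; split=> [p Up|w].
  by apply: differentiableM; [exact: df|exact: dg].
apply: isC_ext (isCD (IH _ _ (isC_pred Cf) (Dg w))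
                     (IH _ _ (isC_pred Cg) (Df w))) => p Up.
by rewrite -deriveM//; apply: diff_derivable; [exact: df|exact: dg].
Qed.

Lemma isCV n f : (forall p, U p -> f p != 0) ->
  isC n U f -> isC n U (fun p => (f p)^-1).
Proof.
move=> f0; elim: n => [|n IH].
  by move=> cf p Up; apply: continuousV; [exact: f0|exact: cf].
move=> Cf; have [df Df] := Cf; split=> [p Up|w].
  by apply: differentiableV; [exact: df|exact: f0].
(* The derivative of 1/f along w is -(1/f)^2 times that of f, and 1/f is already C^n by
   induction. *)
have CV := IH (isC_pred Cf).
apply: isC_ext (isCM (isC_cst n (- 1)) (isCM (isCM CV CV) (Df w))) => p Up.
rewrite deriveV//; [|exact: f0|by apply: diff_derivable; exact: df].
by rewrite /GRing.scale/= expr2 invfM mulN1r mulNr.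
Qed.

Lemma isC_linear n (f : {linear V -> R}) : continuous f -> isC n U f.
Proof.
move=> cf; case: n => [p _|n]; first exact: cf.
split=> [p _|w]; first exact: linear_differentiable.
apply: isC_ext (isC_cst n (f w)) => p _.
by rewrite deriveE ?diff_lin//; exact: linear_differentiable.
Qed.

End FiniteOrderSmoothness.

(** * The path c_t = [perturb t] and its time derivative at 0 *)

Section VanishingPerturbation.
Variable R : realType.
Implicit Types t x : R.

(** A cutoff that is 1 on ]0, 1[ at t = 0, while for each fixed t != 0 it vanishes to second order
    as x tends to 0 or 1. *)
Definition plateau t x : R :=
  (x * (1 - x)) ^+ 2 / ((x * (1 - x)) ^+ 2 + 4 * t ^+ 2).

Definition perturb t x : R := x + t * plateau t x.

Lemma I01E x : I01 x <-> 0 < x < 1.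
Proof. by rewrite /I01/= in_itv/=. Qed.

Lemma open_I01 : open (@I01 R).
Proof. exact: interval_open. Qed.

Lemma plateau_den_gt0 t x : I01 x -> 0 < (x * (1 - x)) ^+ 2 + 4 * t ^+ 2.
Proof.
move=> /I01E/andP[x0 x1]; apply: ltr_pwDl.
  by rewrite exprn_gt0// mulr_gt0// subr_gt0.
by rewrite mulr_ge0 ?sqr_ge0.
Qed.

(** The general arguments [T] and [X] cover smoothness in x alone, in t alone and in (t, x)
    jointly. *)
Lemma isC_plateau (V : normedModType R) (U : set V) (T X : V -> R) n :
  open U -> (forall p, U p -> I01 (X p)) -> isC n U T -> isC n U X ->
  isC n U (fun p => plateau (T p) (X p)).
Proof.
move=> oU UX CT CX.
have CQ : isC n U (fun p => (X p * (1 - X p)) ^+ 2).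
  (* The difference is rewritten with constants, sums and products, to which the closure lemmas
     apply. *)
  have CQ1 : isC n U (fun p => X p * (1 + - 1 * X p)).
    by do ![apply: isCM => //|apply: isCD => //|apply: isC_cst => //].
  by apply: isC_ext (isCM oU CQ1 CQ1) => // p _; rewrite expr2 mulN1r.
apply: isCM => //; apply: isCV => //.
  by move=> p /UX XI; rewrite gt_eqF// plateau_den_gt0.
apply: isCD => //; apply: isCM => //; first exact: isC_cst.
by apply: isC_ext (isCM oU CT CT) => // p _; rewrite expr2.
Qed.

Lemma isC_perturb (V : normedModType R) (U : set V) (T X : V -> R) n :
  open U -> (forall p, U p -> I01 (X p)) -> isC n U T -> isC n U X ->
  isC n U (fun p => perturb (T p) (X p)).
Proof.
move=> oU UX CT CX; apply: isCD => //; apply: isCM => //.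
exact: isC_plateau.
Qed.

(* AM-GM: 4 |t| q <= q^2 + 4 t^2 for q = x (1 - x). *)
Lemma perturb_dist t x : I01 x -> `|perturb t x - x| <= x * (1 - x) / 4.
Proof.
move=> xI; have den0 := plateau_den_gt0 t xI; move/I01E: xI => /andP[x0 x1].
have q0 : 0 < x * (1 - x) by rewrite mulr_gt0// subr_gt0.
rewrite /perturb /plateau; move: (x * (1 - x)) q0 den0 => q q0 den0.
rewrite addrAC subrr add0r mulrA normrM normrV ?unitfE ?gt_eqF//.
rewrite (gtr0_norm den0) ler_pdivrMr// normrM (gtr0_norm (exprn_gt0 2 q0)).
rewrite -(real_normK (num_real t)).
move: `|t| (normr_ge0 t) => s s0.
have : 0 <= q * (q - 2 * s) ^+ 2 by rewrite mulr_ge0 ?sqr_ge0// ltW.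
nra.
Qed.

(** The displacement bound x (1 - x) / 4 is smaller than both x and 1 - x. *)
Lemma perturb_I01 t x : I01 x -> I01 (perturb t x).
Proof.
move=> xI; have := perturb_dist t xI; move/I01E: xI => /andP[x0 x1].
rewrite ler_norml => /andP[lo hi]; apply/I01E/andP; split; nra.
Qed.

Lemma perturb_cvg0 t : perturb t x @[x --> 0^'+] --> (0 : R).
Proof.
apply: (@squeeze_cvgr _ _ _ _ (fun=> 0) (fun x => 2 * x)).
- near=> x; have xI : I01 x by apply/I01E/andP; split.
  have := perturb_dist t xI; have /I01E/andP[y0 _] := perturb_I01 t xI.
  move/I01E: xI => /andP[x0 x1].
  rewrite ler_norml => /andP[lo hi]; rewrite (ltW y0)/=; nra.
- exact: cvg_cst.
- rewrite -[X in _ --> X](mulr0 2); apply: cvgM; first exact: cvg_cst.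
  exact/cvg_at_right_filter/cvg_id.
Unshelve. all: by end_near. Qed.

Lemma perturb_cvg1 t : perturb t x @[x --> 1^'-] --> (1 : R).
Proof.
(* The lower bound is x - (1 - x), since the displacement is at most 1 - x. *)
apply: (@squeeze_cvgr _ _ _ _ (fun x => 2 * x - 1) (fun=> 1)).
- near=> x; have xI : I01 x by apply/I01E/andP; split.
  have := perturb_dist t xI; have /I01E/andP[_ y1] := perturb_I01 t xI.
  move/I01E: xI => /andP[x0 x1].
  rewrite ler_norml => /andP[lo hi]; rewrite (ltW y1) andbT; nra.
- rewrite -[X in _ --> X](_ : 2 * 1 - 1 = 1); last by ring.
  apply: cvgB; last exact: cvg_cst.
  apply: cvgM; first exact: cvg_cst.
  exact/cvg_at_left_filter/cvg_id.
- exact: cvg_cst.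
Unshelve. all: by end_near. Qed.

(** With N = q^2 and q = x (1 - x), the quotient rule turns t N / (N + 4 t^2) into 4 t^3 N' / (N + 4
    t^2)^2, where N' = 2 q (1 - 2 x). *)
Lemma derive_perturb t x : I01 x ->
  (perturb t)^`() x =
  1 + 8 * t ^+ 3 * (x * (1 - x)) * (1 - 2 * x) /
      ((x * (1 - x)) ^+ 2 + 4 * t ^+ 2) ^+ 2.
Proof.
move=> xI; have den0 := lt0r_neq0 (plateau_den_gt0 t xI).
pose N : R -> R := fun x => (x * (1 - x)) ^+ 2.
have dN : is_derive x 1 N (2 * (x * (1 - x)) * (1 - 2 * x)).
  have d1 : is_derive x 1 (fun x : R => 1 - x) (- 1).
    have := is_deriveB (is_derive_cst (1 : R) x (1 : R)) (is_derive_id x (1 : R)).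
    by rewrite sub0r.
  have dq := is_deriveM (is_derive_id x (1 : R)) d1.
  have := is_deriveX 2 dq.
  by move=> H; apply: is_derive_eq H _; rewrite !fctE /GRing.scale/=; ring.
have dD : is_derive x 1 (fun x => N x + 4 * t ^+ 2)
      (2 * (x * (1 - x)) * (1 - 2 * x)).
  have := is_deriveD dN (is_derive_cst (4 * t ^+ 2) x (1 : R)).
  by move=> H; apply: is_derive_eq H _; rewrite addr0.
have dDV := is_deriveV (f := fun x => N x + 4 * t ^+ 2) den0 dD.
have := is_deriveD (is_derive_id x (1 : R))
         (is_deriveM (is_derive_cst t x (1 : R)) (is_deriveM dN dDV)).
move=> [_ H]; rewrite derive1E; etransitivity; first exact: H.
rewrite /N /GRing.scale/= /cst; field.
exact: den0.
Qed.

Lemma derive_perturb_ge t x : I01 x -> 2^-1 <= (perturb t)^`() x.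
Proof.
move=> xI; rewrite derive_perturb//.
have den0 := plateau_den_gt0 t xI; move/I01E: (xI) => /andP[x0 x1].
have q0 : 0 < x * (1 - x) by rewrite mulr_gt0// subr_gt0.
suff : - (2^-1) <= 8 * t ^+ 3 * (x * (1 - x)) * (1 - 2 * x) /
      ((x * (1 - x)) ^+ 2 + 4 * t ^+ 2) ^+ 2 by lra.
rewrite ler_pdivlMr ?exprn_gt0//.
suff : `|8 * t ^+ 3 * (x * (1 - x)) * (1 - 2 * x)| <=
       2^-1 * ((x * (1 - x)) ^+ 2 + 4 * t ^+ 2) ^+ 2.
  by rewrite ler_norml mulNr => /andP[].
(* Once this factor is bounded by 1, there remains 16 |t|^3 q <= (q^2 + 4 t^2)^2. *)
have r1 : `|1 - 2 * x| <= 1 by rewrite ler_norml; lra.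
rewrite normrM -[leRHS]mulr1 ler_pM//.
move: (x * (1 - x)) q0 => q q0.
rewrite 2!normrM normrX (gtr0_norm q0) (ger0_norm (ler0n _ 8)).
rewrite -(real_normK (num_real t)).
move: `|t| (normr_ge0 t) => s s0.
(* The two factors of 16 s^3 q are each bounded by the denominator. *)
have h1 : 4 * s * q <= q ^+ 2 + 4 * s ^+ 2 by have := sqr_ge0 (q - 2 * s); nra.
have h2 : 4 * s ^+ 2 <= q ^+ 2 + 4 * s ^+ 2 by have := sqr_ge0 q; nra.
have := ler_pM _ _ h1 h2.
rewrite !mulr_ge0 ?exprn_ge0 ?(ltW q0)// => /(_ isT isT).
nra.
Qed.

Lemma D_perturb t : D (perturb t).
Proof.
split.
- move=> n; apply: isC_perturb => //.
    by apply: isC_cst; exact: open_I01.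
  by apply: (@isC_linear _ _ _ open_I01 n idfun) => x; exact: cvg_id.
- by move=> x; exact: perturb_I01.
- exact: perturb_cvg0.
- exact: perturb_cvg1.
- apply: (@lt_le_trans _ _ (2^-1)%:E); first by rewrite lte_fin invr_gt0.
  apply: le_ereal_inf_tmp => _ [x xI <-].
  by rewrite lee_fin; exact: derive_perturb_ge.
Qed.

Lemma open_setT_I01 : open ([set: R] `*` @I01 R).
Proof.
rewrite setTX; apply: open_comp open_I01 => p _; exact: cvg_snd.
Qed.

Lemma smooth_path_perturb : smooth_path [set: R] perturb.
Proof.
split=> [t _|p pS]; first exact: D_perturb.
exists ([set: R] `*` @I01 R), (fun p => perturb p.1 p.2); split => //.
  exact: open_setT_I01.
move=> n; apply: isC_perturb.
- exact: open_setT_I01.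
- by move=> q [].
- apply: (@isC_linear _ _ _ open_setT_I01 n fst) => q; exact: cvg_fst.
- apply: (@isC_linear _ _ _ open_setT_I01 n snd) => q; exact: cvg_snd.
Qed.

(** In the product rule for t * [plateau t x], the derivative of the plateau is multiplied by t = 0;
    only its value q^2 / q^2 = 1 survives. *)
Lemma derive_perturb_time0 x : I01 x -> derive1 (perturb^~ x) 0 = 1.
Proof.
move=> xI.
have [dp _] : isC 1 [set: R] (plateau^~ x).
  apply: isC_plateau => //; first exact: openT.
    apply: (@isC_linear _ _ _ openT 1%N idfun) => y; exact: cvg_id.
  exact/isC_cst/openT.
have /derivableP d := (@diff_derivable _ _ _ _ _ (1 : R) (dp 0 I)).
have [_ H] := is_deriveD (is_derive_cst x (0 : R) (1 : R))
               (is_deriveM (is_derive_id (0 : R) (1 : R)) d).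
rewrite derive1E; etransitivity; first exact: H.
rewrite /GRing.scale/= mul0r !add0r mulr1 /plateau expr0n/= mulr0 addr0 divff//.
by have := lt0r_neq0 (plateau_den_gt0 0 xI); rewrite expr0n/= mulr0 addr0.
Qed.

Lemma tangent_cone_id1 : tangent_cone_id (fun=> 1 : R).
Proof.
exists perturb; split; first exact: smooth_path_perturb.
- by move=> x _; rewrite /perturb mul0r addr0.
- by move=> x xI; rewrite derive_perturb_time0.
Qed.

End VanishingPerturbation.

(** * Trajectories of a path with constant velocity 1 *)

Section ConstantVelocity.
Variable R : realType.
Implicit Types (f : R -> R) (g : R -> R -> R) (J : set R).

(** The positive infimum of f' makes f strictly increasing. Injectivity is what turns [inv01 f] into
    a left inverse of f on ]0, 1[. *)
Lemma D_inj f : D f -> {in @I01 R &, injective f}.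
Proof.
move=> [sf _ _ _ f'0] x y xI yI fxy.
have [df _] := sf 1%N.
have dv z : z \in `]0, 1[%R -> derivable f z 1.
  by move=> zI; apply/derivable1_diffP; exact: df.
have f'gt0 z : z \in `]0, 1[%R -> 0 < derive1 f z.
  move=> zI; rewrite -lte_fin; apply: lt_le_trans f'0 _.
  by apply: ge_ereal_inf; exists (derive1 f z)%:E => //; exists z.
have cf : {in `]0, 1[, continuous f}.
  move=> z; rewrite inE => zI; apply: differentiable_continuous; exact: df.
have homo := gtr0_derive1_lt_oo dv f'gt0 cf.
move: xI yI; rewrite !inE => xI yI.
have [xy|yx|//] := ltgtP x y.
  by have := homo _ _ xI yI xy; rewrite fxy ltxx.
by have := homo _ _ yI xI yx; rewrite fxy ltxx.
Qed.

Lemma inv01K f y : D f -> I01 y -> inv01 f (f y) = y.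
Proof. by move=> Df yI; rewrite /inv01 pinvKV// ?inE//; exact: D_inj. Qed.

(** A slice of a local smooth extension of [g] is differentiable on both sides of t, even when t is
    an endpoint of [J]. *)
Lemma jointly_smooth_section J g t y : jointly_smooth J g -> J t -> I01 y ->
  exists k : R -> R,
    derivable k t 1 /\ \forall s \near t, J s -> k s = g s y.
Proof.
move=> sg Jt yI; have [U [h [oU Ut sh hg]]] := sg (t, y) (conj Jt yI).
have [dh _] := sh 1%N.
exists (fun s => h (s, y)); split.
  apply/derivable1_diffP.
  apply: (@differentiable_comp _ _ _ _ (fun s : R => (s, y)) h _); last exact: dh.
  by apply: differentiable_pair; [exact/derivable1_diffP/derivable_id|
    exact: differentiable_cst].
have cU : \forall s \near t, U (s, y).
  have : (s, y) @[s --> t] --> (t, y).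
    exact: (cvg_pair (f := idfun) (g := fun=> y) cvg_id (cvg_cst y)).
  by apply; exact: open_nbhs_nbhs.
by apply: filterS cU => s Us Js; rewrite (hg (s, y)).
Qed.

(** Here [J] is a neighbourhood of t, so restricting increments to [J] leaves the punctured filter
    at t unchanged; the substitution s = h + t does the rest. *)
Lemma derive_in_interior J f t : J° t -> derivable f t 1 ->
  derive_in J f t = derive1 f t.
Proof.
move=> Jt df.
have -> : derive_in J f t = lim ((s - t)^-1 * (f s - f t) @[s --> t^']).
  rewrite /derive_in; congr (lim (_ @ _)).
  rewrite eqEsubset; split=> A; rewrite /within/=; last first.
    by apply: filterS => s As _.
  move=> A1; have : \forall s \near t^', J s by apply: nbhs_dnbhs.
  by move: A1; apply: filterS2 => s + Js; exact.
apply: cvg_lim => //.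
have H : h^-1 *: (f (h + t) - f t) @[h --> 0^'] --> derive1 f t.
  have -> : (fun h => h^-1 *: (f (h + t) - f t)) =
      (fun h => h^-1 *: ((f \o shift t) (h *: 1) - f t)).
    by apply/funext => h /=; rewrite [h%:A]mulr1.
  by rewrite derive1E; exact: df.
apply: cvg_trans H => A.
change ((\forall h \near (0 : R), h != 0 -> A (h^-1 *: (f (h + t) - f t))) ->
        \forall s \near t, s != t -> A ((s - t)^-1 * (f s - f t))).
rewrite (near_shift t) => H; near=> s => st.
have : (s - t != 0 -> A ((s - t)^-1 *: (f (s - t + t) - f t))).
  by near: s; move: H; apply: filterS => s /=; rewrite sub0r.
by rewrite subrK subr_eq0; exact.
Unshelve. all: by end_near. Qed.

(** The trajectory of y has speed 1 at interior times and is continuous up to the endpoints, so the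
    mean value theorem applies on [0, 1]. *)
Lemma constant_velocity_displacement g :
  smooth_path `[0, 1] g ->
  (forall t x : R, `[0, 1] t -> I01 x ->
     derive_in `[0, 1] (fun s => g s (inv01 (g t) x)) t = 1) ->
  forall y, I01 y -> g 1 y - g 0 y = 1.
Proof.
move=> [gD sg] eqg y yI.
pose phi s := g s y.
have loc (t : R) : `[0, 1]%classic t -> exists k : R -> R,
    derivable k t 1 /\ \forall s \near t, `[0, 1]%classic s -> k s = phi s.
  by move=> tJ; exact: jointly_smooth_section sg tJ yI.
have dphi (t : R) : t \in `]0, 1[%R -> is_derive t 1 phi 1.
  move=> tI.
  have tJ : `[0, 1]%classic t by exact: subset_itv_oo_cc.
  have Jt : (`[0, 1]%classic : set R)° t.
    by have := near_in_itvoo tI; apply: filterS => s; exact: subset_itv_oo_cc.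
  have [k [dk kphi]] := loc t tJ.
  have d : derivable phi t 1.
    apply: near_eq_derivable dk; near=> s; apply: (near kphi s) => //.
    by near: s; exact: Jt.
  apply: DeriveDef => //; rewrite -derive1E -(derive_in_interior Jt d).
  have [_ gI _ _ _] := gD t tJ.
  (* The equation is taken at the moving point x = g_t(y), whose preimage is the fixed y. *)
  by have := eqg t (g t y) tJ (gI _ yI); rewrite inv01K//; exact: gD.
(* Near each t, endpoints included, [phi] agrees within [0, 1] with a function [k] continuous at
   t. *)
have cphi : {within `[0, 1], continuous phi}.
  apply/subspace_continuousP => t tJ; have [k [dk kphi]] := loc t tJ.
  have kt : k t = phi t := nbhs_singleton kphi tJ.
  change (phi @ within `[0, 1]%classic (nbhs t) --> phi t); rewrite -kt.
  have kc : k @ nbhs t --> k t.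
    by apply: differentiable_continuous; exact/derivable1_diffP.
  have kcw : k @ within `[0, 1]%classic (nbhs t) --> k t.
    exact: cvg_within_filter kc.
  by apply: cvg_trans kcw; apply: near_eq_cvg.
have [c _] := MVT ltr01 dphi cphi.
by rewrite subr0 mulr1.
Unshelve. all: by end_near. Qed.

End ConstantVelocity.

Theorem theorem2p2 (R : realType) :
  exists v : R -> R -> R,
    smooth_tangent_path `[0, 1] v /\
    ~ exists g : R -> R -> R,
        smooth_path `[0, 1] g /\
        forall t x, `[0, 1] t -> I01 x ->
          derive_in `[0, 1] (fun s => g s (inv01 (g t) x)) t = v t x.
Proof.
exists (fun _ _ => 1); split.
  split=> [t _|p _]; first exact: tangent_cone_id1.
  exists setT, (fun=> 1); split => // [|n]; first exact: openT.
  by apply: isC_cst; exact: openT.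
move=> [g [sg eqg]]; have [gD _] := sg.
(* Tracking the midpoint, two values in ]0, 1[ would have to differ by exactly 1. *)
have hI : I01 (2^-1 : R) by apply/I01E; lra.
have disp := constant_velocity_displacement sg eqg hI.
have gI (t : R) : 0 <= t <= 1 -> 0 < g t 2^-1 < 1.
  move=> tJ; have [_ gtI _ _ _] : D (g t) by apply: gD; rewrite /= in_itv.
  exact/I01E/gtI.
have /gI/andP[g0_gt0 _] : 0 <= (0 : R) <= 1 by rewrite lexx ler01.
have /gI/andP[_ g1_lt1] : 0 <= (1 : R) <= 1 by rewrite lexx ler01.
lra.
Qed.
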